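(* Let $\mathbf r=(r_0,r_1,r_2,\dots)$ be a sequence with $r_n\in\{-1,1\}$ for all $n\ge 0$, and let $f=f_{\mathbf r}\in\mathcal T_{\pm}$ be the associated signed Takagi function. Put $s_n:=r_0+r_1+\dots+r_{n-1}$ for $n\in\mathbb N$, and for $j\in\mathbb Z\setminus\{0\}$ let $\tau_j:=\inf\{n\in\mathbb N: s_n=j\}$ (with $\inf\emptyset=\infty$). Then $$M(f)=\sum_{k=1}^\infty\left(\frac12\right)^{\tau_{2k-1}}\qquad\text{and}\qquad m(f)=-\sum_{k=1}^\infty\left(\frac12\right)^{\tau_{1-2k}},$$ where $(1/2)^\infty$ is interpreted as $0$. Consequently, $$\operatorname{height}(f)=\sum_{j\in\mathbb Z}\left(\frac12\right)^{\tau_{2j-1}},$$ and in particular $1/2\le \operatorname{height}(f)\le 2/3$. There are uncountably many $f\in\mathcal T_{\pm}$ with $\operatorname{height}(f)=1/2$, but there are only four functions $f\in\mathcal T_{\pm}$ with $\operatorname{height}(f)=2/3$: the functions $\pm T$ and the functions $\pm\tilde T$, where $\tilde T(x)=T(x)-2\phi(x)$.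
   Context: Let $\phi(x)=\operatorname{dist}(x,\mathbb Z)$ denote the distance from $x\in\mathbb R$ to the nearest integer. For a sequence $\mathbf r=(r_n)_{n\ge0}$ with $r_n\in\{-1,1\}$, the signed Takagi function is $f_{\mathbf r}(x)=\sum_{n=0}^\infty \frac{r_n}{2^n}\phi(2^nx)$, a continuous $1$-periodic function. $\mathcal T_{\pm}$ denotes the collection of all functions $f_{\mathbf r}$. $T(x)=\sum_{n=0}^\infty 2^{-n}\phi(2^nx)$ is the Takagi function. $M(f):=\max_{x\in[0,1]}f(x)$, $m(f):=\min_{x\in[0,1]}f(x)$, and $\operatorname{height}(f):=M(f)-m(f)$. $\mathbb N$ is the set of positive integers. *)

(* Defs.v *)
From mathcomp Require Import all_boot all_order all_algebra.
From mathcomp Require Import all_classical all_reals all_analysis.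

Set Implicit Arguments.
Unset Strict Implicit.
Unset Printing Implicit Defensive.

Import Order.TTheory GRing.Theory Num.Theory.
Import numFieldNormedType.Exports.

Local Open Scope classical_set_scope.
Local Open Scope ring_scope.

Definition dist_int {R : realType} (x : R) : R :=
  inf [set `|x - z%:~R| | z in [set: int]].

Definition sign_seq (r : nat -> int) : Prop :=
  forall n, r n = -1 \/ r n = 1.

Definition signed_takagi {R : realType} (r : nat -> int) : R -> R := fun x =>
  limn (series (fun n : nat => (r n)%:~R / 2 ^+ n * dist_int (2 ^+ n * x))).

Definition signed_takagi_class {R : realType} : set (R -> R) :=
  [set f | exists2 r, sign_seq r & f = signed_takagi r].

Definition takagi {R : realType} : R -> R := fun x =>
  limn (series (fun n : nat => (2 ^+ n)^-1 * dist_int (2 ^+ n * x))).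

Definition takagi_tilde {R : realType} : R -> R := fun x =>
  takagi x - 2 * dist_int x.

(* [sup] and [inf] are a maximum and a minimum only when they are attained;
   attainment has to be stated separately. *)
Definition maxval {R : realType} (f : R -> R) : R := sup (f @` `[0, 1]).
Definition minval {R : realType} (f : R -> R) : R := inf (f @` `[0, 1]).
Definition height {R : realType} (f : R -> R) : R := maxval f - minval f.

Definition partial_sum (r : nat -> int) (n : nat) : int := \sum_(i < n) r i.

(* [None] stands for the value oo. *)
Definition hitting_time (r : nat -> int) (j : int) : option nat :=
  match pselect (exists n : nat, (0 < n)%N && (partial_sum r n == j)) with
  | left ex => Some (ex_minn ex)
  | right _ => None
  end.

Definition half_pow {R : realType} (t : option nat) : R :=
  if t is Some n then (1 / 2) ^+ n else 0.

(* Main.v *)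
Require Import Defs.
From mathcomp Require Import all_boot all_order all_algebra.
From mathcomp Require Import all_classical all_reals all_analysis.
From mathcomp Require Import zify ring lra.
Import Order.TTheory GRing.Theory Num.Theory.
Import numFieldNormedType.Exports.
Local Open Scope classical_set_scope.
Local Open Scope ring_scope.

(** Tilting the function turns the computation of its maximum into an exact
    recursion.  Write r' for r with its first term dropped.  Splitting [0, 1]
    at 1/2 in the functional equation
      f_r(x) = r_0 phi(x) + f_{r'}(2x) / 2
    expresses f_r(x) + s (x - 1/2) on each half through the tilted function
    f_{r'}(y) + s' (y - 1/2), where s' = s + r_0 on the left half and
    s' = s - r_0 on the right half.  As f_r is symmetric about 1/2, only s >= 0
    matters, and the claim is that
      max_x (f_r(x) + s (x - 1/2)) = s/2 + sum_(k >= 0) 2^(- tau_{2k+1+s}(r)).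
    The right-hand side obeys the same recursion, because tau_j(r) is
    1 + tau_{j - r_0}(r') for j <> r_0 and 1 for j = r_0.  Both sides are
    s/2 plus a bounded quantity and each step of the recursion halves errors,
    so after n steps they differ by O(2^-n) ([tilted_takagi_le],
    [tilted_takagi_ge]).  At s = 0 this is the formula for M(f);
    the one for m(f) follows from f_{-r} = - f_r and tau_j(-r) = tau_{-j}(r),
    and attainment from the continuity of f.

    For the height, s_n has the parity of n, and distinct levels are hit at
    distinct times, so the sum over odd levels j of 2^(- tau_j) is the sum of
    2^-n over the odd times n at which s_n takes a new value
    ([height_esum_times]).  This set of times contains 1 and is a set of odd
    numbers, whence 1/2 <= height <= 2/3.  The value 2/3 occurs iff i |-> s_{2i+1}
    is injective; this forces r_{2i+1} = r_{2i+2} and then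
    r_{2i+1} = r_{2i+3}, so r is constant from index 1 on and only four sequences
    remain.  The value 1/2 occurs as soon as s_{2i+1} = s_1 for all i, which
    leaves a free binary choice for each i.  Finally r |-> f_r is injective, since
    f_r(1/2) = r_0 / 2 and the functional equation recovers f_{r'} from f_r. *)

(** * Partial sums and hitting times *)

(** The sign sequence with its first term dropped, written r' in the comments. *)
Definition shift_seq (r : nat -> int) : nat -> int := fun n => r n.+1.

Lemma sign_seq_shift (r : nat -> int) : sign_seq r -> sign_seq (shift_seq r).
Proof. by move=> sr n; exact: sr. Qed.

Lemma partial_sumS (r : nat -> int) (n : nat) :
  partial_sum r n.+1 = r 0%N + partial_sum (shift_seq r) n.
Proof. by rewrite /partial_sum big_ord_recl. Qed.

Lemma partial_sumSr (r : nat -> int) (n : nat) :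
  partial_sum r n.+1 = partial_sum r n + r n.
Proof. by rewrite /partial_sum big_ord_recr. Qed.

Lemma partial_sum1 (r : nat -> int) : partial_sum r 1 = r 0%N.
Proof. by rewrite /partial_sum big_ord1. Qed.

Lemma partial_sumN (r : nat -> int) (n : nat) :
  partial_sum (fun i => - r i) n = - partial_sum r n.
Proof. by rewrite /partial_sum sumrN. Qed.

Lemma partial_sum_le (r : nat -> int) (n : nat) :
  sign_seq r -> partial_sum r n <= n%:Z.
Proof.
move=> sr; elim: n => [|n IHn]; first by rewrite /partial_sum big_ord0.
by rewrite partial_sumSr; case: (sr n) => ->; lia.
Qed.

Lemma partial_sum_odd (r : nat -> int) (n : nat) : sign_seq r ->
  exists k : int, partial_sum r n = 2 * k + (odd n : nat)%:Z.
Proof.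
move=> sr; elim: n => [|n [k IHn]].
  by exists 0; rewrite /partial_sum big_ord0.
rewrite partial_sumSr IHn /=.
case: (sr n) => ->; case: (odd n) => /=;
  [exists k|exists (k - 1)|exists (k + 1)|exists k]; lia.
Qed.

(** The defining property of the hitting time of level [j], for case analysis:
    a first positive time at which the partial sum is [j], or [None] if there is
    no such time. *)
Variant hitting_spec (r : nat -> int) (j : int) : option nat -> Prop :=
| HitSome n of (0 < n)%N & partial_sum r n = j
    & (forall m, (0 < m < n)%N -> partial_sum r m <> j) :
    hitting_spec r j (Some n)
| HitNone of (forall n, (0 < n)%N -> partial_sum r n <> j) :
    hitting_spec r j None.

Lemma hittingP (r : nat -> int) (j : int) :
  hitting_spec r j (hitting_time r j).
Proof.
rewrite /hitting_time; case: pselect => [ex|nex].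
  case: ex_minnP => n /andP[n0 /eqP sn] nmin; constructor => // m /andP[m0 mn].
  by move=> sm; move: (nmin m); rewrite m0 sm eqxx leqNgt mn => /(_ isT).
by constructor => n n0 sn; apply: nex; exists n; rewrite n0 sn eqxx.
Qed.

Lemma hitting_unique (r : nat -> int) (j : int) (t : option nat) :
  hitting_spec r j t -> hitting_time r j = t.
Proof.
case: hittingP => [n n0 sn nmin|nv] [m m0 sm mmin|mv] //.
- congr Some; apply/eqP; rewrite eqn_leq; apply/andP; split; rewrite leqNgt;
    apply/negP => lt.
  + by apply: (nmin m) => //; rewrite m0.
  + by apply: (mmin n) => //; rewrite n0.
- by case: (mv n).
- by case: (nv m).
Qed.

Lemma hitting_time_first (r : nat -> int) : hitting_time r (r 0%N) = Some 1%N.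
Proof.
by apply: hitting_unique; constructor => //; [exact: partial_sum1|case].
Qed.

Lemma hitting_time_shift (r : nat -> int) (j : int) : j <> r 0%N ->
  hitting_time r j = omap succn (hitting_time (shift_seq r) (j - r 0%N)).
Proof.
move=> jr; apply: hitting_unique.
case: hittingP => [n n0 sn nmin|nv] /=; constructor => //.
- by rewrite partial_sumS sn addrC subrK.
- move=> [|[|m]] //; first by move=> _; rewrite partial_sum1 => /esym.
  move=> lt; rewrite partial_sumS => sm; apply: (nmin m.+1) => //.
  by rewrite -sm addrAC subrr add0r.
- move=> [|[|m]] // _; first by rewrite partial_sum1 => /esym.
  by rewrite partial_sumS => sm; apply: (nv m.+1) => //; rewrite -sm addrAC subrr add0r.
Qed.

Lemma hitting_timeN (r : nat -> int) (j : int) :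
  hitting_time (fun i => - r i) j = hitting_time r (- j).
Proof.
apply: hitting_unique; case: hittingP => [n n0 sn nmin|nv]; constructor => //.
- by rewrite partial_sumN sn opprK.
- by move=> m mn; rewrite partial_sumN => /(congr1 -%R); rewrite opprK; exact: nmin.
- by move=> n n0; rewrite partial_sumN => /(congr1 -%R); rewrite opprK; exact: nv.
Qed.

(** * The sums of weights of hitting times *)

(** The weight 2^(- tau_j) of level [j], equal to 0 if the level is never hit. *)
Definition hit_weight {R : realType} (r : nat -> int) (j : int) : R :=
  half_pow (hitting_time r j).

Lemma half_pow_ge0 {R : realType} (t : option nat) : 0 <= half_pow t :> R.
Proof. by case: t => //= n; rewrite exprn_ge0// divr_ge0. Qed.

Lemma hit_weight_ge0 {R : realType} (r : nat -> int) (j : int) :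
  0 <= hit_weight r j :> R.
Proof. exact: half_pow_ge0. Qed.

Lemma hit_weight_first {R : realType} (r : nat -> int) :
  hit_weight r (r 0%N) = 1 / 2 :> R.
Proof. by rewrite /hit_weight hitting_time_first /= expr1. Qed.

Lemma hit_weight_shift {R : realType} (r : nat -> int) (j : int) :
  j <> r 0%N ->
  hit_weight r j = 1 / 2 * hit_weight (shift_seq r) (j - r 0%N) :> R.
Proof.
move=> jr; rewrite /hit_weight hitting_time_shift//.
by case: hitting_time => [n|] /=; rewrite ?exprS ?mulr0.
Qed.

(** Level [j] cannot be hit before time [j]. *)
Lemma hit_weight_le {R : realType} (r : nat -> int) (j : nat) : sign_seq r ->
  hit_weight r j%:Z <= (1 / 2) ^+ j :> R.
Proof.
move=> sr; rewrite /hit_weight; case: hittingP => [n n0 sn _|_] /=.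
  by apply: ler_wiXn2l; [lra|lra|have := partial_sum_le r n sr; rewrite sn; lia].
by rewrite exprn_ge0// divr_ge0.
Qed.

Lemma series_recl_cvg {R : realType} (u : nat -> R) :
  cvgn (series u) -> cvgn (series (fun n => u n.+1)) /\
  limn (series u) = u 0%N + limn (series (fun n => u n.+1)).
Proof.
move=> cu; have : series (fun n => u n.+1) @ \oo --> limn (series u) - u 0%N.
  have -> : series (fun n => u n.+1) = (fun n => series u n.+1 - u 0%N).
    apply/funext => n; rewrite /series /= big_nat_recl//=.
    by rewrite addrAC subrr add0r.
  apply: cvgB; last exact: cvg_cst.
  by rewrite (cvg_shiftS (series u)).
by move=> cv; split; [apply: cvgP cv|rewrite (cvg_lim _ cv)// addrC subrK].
Qed.

Lemma lim_series_mull {R : realType} (c : R) (u : nat -> R) :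
  cvgn (series u) -> limn (series (fun n => c * u n)) = c * limn (series u).
Proof. by move=> cu; exact: (lim_seriesZ c cu). Qed.

Lemma cvg_series_half {R : realType} :
  series (fun n : nat => (1 / 2 : R) ^+ n) @ \oo --> (2 : R).
Proof.
have -> : (fun n : nat => (1 / 2 : R) ^+ n) = geometric 1 (1 / 2).
  by apply/funext => n; rewrite [RHS]mul1r.
have e2 : 1 / (1 - 1 / 2) = 2 :> R by field.
by rewrite -[X in _ --> X]e2; apply: cvg_geometric_series; rewrite ger0_norm; lra.
Qed.

(** The sum of 2^(- tau_j) over the levels j = s + 1, s + 3, s + 5, ...; the
    maximum of f_r(x) + s (x - 1/2) on [0, 1] turns out to be [s / 2 + tail_sum r s]. *)
Definition tail_sum {R : realType} (r : nat -> int) (s : nat) : R :=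
  limn (series (fun k : nat => hit_weight r (2 * k + 1 + s)%N%:Z : R)).

Lemma tail_weight_le {R : realType} (r : nat -> int) (s k : nat) : sign_seq r ->
  hit_weight r (2 * k + 1 + s)%N%:Z <= 1 / 2 * (1 / 2) ^+ k :> R.
Proof.
move=> sr; apply: (le_trans (hit_weight_le _ _ sr)); rewrite -exprS.
by apply: ler_wiXn2l; [lra|lra|lia].
Qed.

Lemma is_cvg_tail_sum {R : realType} (r : nat -> int) (s : nat) : sign_seq r ->
  cvgn (series (fun k : nat => hit_weight r (2 * k + 1 + s)%N%:Z : R)).
Proof.
move=> sr; apply: (@series_le_cvg _ _ (fun k => 1 / 2 * (1 / 2) ^+ k)).
- by move=> n; exact: hit_weight_ge0.
- by move=> n; rewrite mulr_ge0// ?exprn_ge0//; lra.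
- by move=> n; exact: tail_weight_le.
- by apply: is_cvg_seriesZ; apply: cvgP cvg_series_half.
Qed.

Lemma tail_sum_ge0 {R : realType} (r : nat -> int) (s : nat) : sign_seq r ->
  0 <= tail_sum r s :> R.
Proof.
move=> sr; apply: limr_ge; first exact: is_cvg_tail_sum.
by near=> n; apply: sumr_ge0 => i _; exact: hit_weight_ge0.
Unshelve. all: by end_near. Qed.

Lemma tail_sum_le1 {R : realType} (r : nat -> int) (s : nat) : sign_seq r ->
  tail_sum r s <= 1 :> R.
Proof.
move=> sr.
have c2 : cvgn (series (fun n : nat => (1 / 2 : R) ^+ n)).
  by apply: cvgP cvg_series_half.
apply: (@le_trans _ _ (limn (series (fun k => 1 / 2 * (1 / 2 : R) ^+ k)))).
  apply: lim_series_le; [exact: is_cvg_tail_sum|exact: is_cvg_seriesZ|].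
  by move=> n; exact: tail_weight_le.
rewrite lim_series_mull// (cvg_lim _ cvg_series_half)//.
by rewrite div1r mulVf.
Qed.

Lemma tail_sum_recl {R : realType} (r : nat -> int) (s : nat) : sign_seq r ->
  tail_sum r s = hit_weight r s.+1%:Z + tail_sum r s.+2 :> R.
Proof.
move=> sr; rewrite /tail_sum (series_recl_cvg _ (is_cvg_tail_sum r s sr)).2.
congr (hit_weight r _ + limn (series _)).
by apply/funext => k; congr (hit_weight r _); lia.
Qed.

(** The next three lemmas are the recursion of [tail_sum] in [r]; the level
    1 = r_0, hit at time 1, gives the additional 1/2 in [tail_sum_up0]. *)
Lemma tail_sum_up {R : realType} (r : nat -> int) (s : nat) : sign_seq r ->
  r 0%N = 1 -> tail_sum r s.+1 = 1 / 2 * tail_sum (shift_seq r) s :> R.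
Proof.
move=> sr r0; rewrite /tail_sum -lim_series_mull; last first.
  by apply: is_cvg_tail_sum; exact: sign_seq_shift.
congr (limn (series _)); apply/funext => k.
rewrite hit_weight_shift; last by rewrite r0; lia.
by congr (_ * hit_weight _ _); rewrite r0; lia.
Qed.

Lemma tail_sum_down {R : realType} (r : nat -> int) (s : nat) : sign_seq r ->
  r 0%N = -1 -> tail_sum r s = 1 / 2 * tail_sum (shift_seq r) s.+1 :> R.
Proof.
move=> sr r0; rewrite /tail_sum -lim_series_mull; last first.
  by apply: is_cvg_tail_sum; exact: sign_seq_shift.
congr (limn (series _)); apply/funext => k.
rewrite hit_weight_shift; last by rewrite r0; lia.
by congr (_ * hit_weight _ _); rewrite r0; lia.
Qed.

Lemma tail_sum_up0 {R : realType} (r : nat -> int) : sign_seq r ->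
  r 0%N = 1 -> tail_sum r 0 = 1 / 2 + 1 / 2 * tail_sum (shift_seq r) 1 :> R.
Proof.
move=> sr r0; rewrite tail_sum_recl//; congr (_ + _).
  by rewrite -[in LHS](_ : r 0%N = 1%:Z)// hit_weight_first.
by rewrite tail_sum_up.
Qed.

Lemma half_pow_small {R : realType} (c e : R) : 0 < e ->
  exists n : nat, c * (1 / 2) ^+ n < e.
Proof.
move=> e0; have : (fun n : nat => c * (1 / 2) ^+ n) @ \oo --> (0 : R).
  by apply: (@cvg_geometric _ c (1 / 2)); rewrite ger0_norm; lra.
move=> /cvgrPdist_lt /(_ e e0)[n _ /(_ n (leqnn n))] /=.
by rewrite sub0r normrN => h; exists n; apply: le_lt_trans h; exact: ler_norm.
Qed.

Lemma le_half_pow {R : realType} (a b c : R) :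
  (forall n : nat, a <= b + c * (1 / 2) ^+ n) -> a <= b.
Proof.
move=> h; rewrite leNgt; apply/negP => ba.
have [|n hn] := @half_pow_small R c (a - b); first by lra.
by have := h n; lra.
Qed.

(** * The distance to the nearest integer *)

Lemma dist_int_le {R : realType} (x : R) (z : int) :
  dist_int x <= `|x - z%:~R|.
Proof.
apply: ge_inf; last by exists z.
by exists 0 => _ [w _ <-].
Qed.

Lemma le_dist_int {R : realType} (x c : R) :
  (forall z : int, c <= `|x - z%:~R|) -> c <= dist_int x.
Proof.
move=> h; apply: lb_le_inf; first by exists `|x - 0%:~R|; exists 0.
by move=> _ [z _ <-].
Qed.

Lemma dist_int_ge0 {R : realType} (x : R) : 0 <= dist_int x.
Proof. exact: le_dist_int. Qed.

Lemma dist_int_le1 {R : realType} (x : R) : dist_int x <= 1.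
Proof.
apply: (le_trans (dist_int_le x (Num.floor x))).
have /andP[] := floor_itv x; rewrite intrD => l u.
by rewrite ger0_norm; lra.
Qed.

Lemma dist_intD {R : realType} (x : R) (z : int) :
  dist_int (x + z%:~R) = dist_int x.
Proof.
apply: le_anti; apply/andP; split; apply: le_dist_int => w.
- apply: (le_trans (dist_int_le _ (w + z))).
  by rewrite intrD opprD addrACA subrr addr0.
- apply: (le_trans (dist_int_le _ (w - z))).
  by rewrite intrB opprB addrA.
Qed.

Lemma dist_intN {R : realType} (x : R) : dist_int (- x) = dist_int x.
Proof.
apply: le_anti; apply/andP; split; apply: le_dist_int => w;
  apply: (le_trans (dist_int_le _ (- w))); rewrite intrN opprK.
- by rewrite -normrN opprD opprK.
- by rewrite -normrN opprD.
Qed.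

Lemma dist_int_lower_half {R : realType} (x : R) :
  0 <= x <= 1 / 2 -> dist_int x = x.
Proof.
move=> /andP[x0 x1]; apply: le_anti; apply/andP; split.
  by apply: (le_trans (dist_int_le x 0)); rewrite subr0 ger0_norm.
apply: le_dist_int => z; have [z0|z1] := lerP z 0.
  have : z%:~R <= 0 :> R by rewrite lerz0.
  by move=> h; rewrite ger0_norm; lra.
have : 1 <= z%:~R :> R by rewrite -[1]/(1%:~R) ler_int; lia.
by move=> h; rewrite ler0_norm; lra.
Qed.

Lemma dist_int_upper_half {R : realType} (x : R) :
  1 / 2 <= x <= 1 -> dist_int x = 1 - x.
Proof.
move=> /andP[x0 x1]; rewrite -dist_intN -(dist_intD _ 1) addrC.
by apply: dist_int_lower_half; lra.
Qed.

Lemma dist_int_lipschitz {R : realType} (x y : R) :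
  `|dist_int x - dist_int y| <= `|x - y|.
Proof.
have h (a b : R) : dist_int a <= `|a - b| + dist_int b.
  rewrite -lerBlDl; apply: le_dist_int => z; rewrite lerBlDl.
  apply: (le_trans (dist_int_le a z)).
  by rewrite -[X in `|X|](_ : a - b + (b - z%:~R) = _) ?ler_normD//; ring.
by have := h x y; have := h y x; rewrite distrC ler_norml => ? ?; lra.
Qed.

(** * Signed Takagi functions *)

Lemma sign_seq_intr {R : realType} (r : nat -> int) (n : nat) :
  sign_seq r -> (r n)%:~R = -1 :> R \/ (r n)%:~R = 1 :> R.
Proof. by move=> sr; case: (sr n) => ->; [left|right]; rewrite ?mulrN1z. Qed.

Lemma sign_norm {R : realType} (r : nat -> int) (n : nat) :
  sign_seq r -> `|(r n)%:~R| = 1 :> R.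
Proof. by move=> sr; case: (@sign_seq_intr R r n sr) => ->; rewrite ?normrN normr1. Qed.

Lemma takagi_term_le {R : realType} (r : nat -> int) (x : R) (n : nat) :
  sign_seq r ->
  `|(r n)%:~R / 2 ^+ n * dist_int (2 ^+ n * x)| <= (1 / 2) ^+ n.
Proof.
move=> sr; rewrite !normrM sign_norm// mul1r (ger0_norm (dist_int_ge0 _)).
rewrite ger0_norm; last by rewrite invr_ge0 exprn_ge0.
rewrite -[leRHS]mulr1 div1r exprVn.
by apply: ler_wpM2l; [rewrite invr_ge0 exprn_ge0|exact: dist_int_le1].
Qed.

Lemma is_cvg_normed_takagi {R : realType} (r : nat -> int) (x : R) :
  sign_seq r ->
  cvgn [normed series (fun n : nat =>
    (r n)%:~R / 2 ^+ n * dist_int (2 ^+ n * x))].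
Proof.
move=> sr; apply: (@series_le_cvg _ _ (fun n => (1 / 2) ^+ n)).
- by move=> n; exact: normr_ge0.
- by move=> n; apply: exprn_ge0; lra.
- by move=> n; exact: takagi_term_le.
- by apply: cvgP cvg_series_half.
Qed.

Lemma is_cvg_takagi {R : realType} (r : nat -> int) (x : R) :
  sign_seq r ->
  cvgn (series (fun n : nat => (r n)%:~R / 2 ^+ n * dist_int (2 ^+ n * x))).
Proof. by move=> sr; apply: normed_cvg; exact: is_cvg_normed_takagi. Qed.

Lemma signed_takagi_bound {R : realType} (r : nat -> int) (x : R) :
  sign_seq r -> `|signed_takagi r x| <= 2.
Proof.
move=> sr; have c := is_cvg_normed_takagi r x sr.
apply: (le_trans (lim_series_norm c)).
rewrite -[leRHS](cvg_lim (@Rhausdorff R) cvg_series_half).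
apply: lim_series_le; [exact: c|by apply: cvgP cvg_series_half|].
by move=> n; exact: takagi_term_le.
Qed.

Lemma signed_takagi_rec {R : realType} (r : nat -> int) (x : R) :
  sign_seq r -> signed_takagi r x =
    (r 0%N)%:~R * dist_int x + 1 / 2 * signed_takagi (shift_seq r) (2 * x).
Proof.
move=> sr; rewrite {1}/signed_takagi (series_recl_cvg _ (is_cvg_takagi r x sr)).2.
rewrite expr0 divr1 [1 * x]mul1r /signed_takagi; congr (_ + _).
rewrite -lim_series_mull; last by apply: is_cvg_takagi; exact: sign_seq_shift.
congr (limn (series _)); apply/funext => n.
rewrite /shift_seq !exprS invfM -[2 * 2 ^+ n * x]mulrA [2 * (2 ^+ n * x)]mulrCA; ring.
Qed.

Lemma signed_takagiD1 {R : realType} (r : nat -> int) (x : R) :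
  signed_takagi r (x + 1) = signed_takagi r x.
Proof.
congr (limn (series _)); apply/funext => n; congr (_ * _).
rewrite -(dist_intD (_ * x) (2 ^ n)%N%:Z) -[in RHS]pmulrn natrX.
by rewrite mulrDr mulr1.
Qed.

Lemma signed_takagi_even {R : realType} (r : nat -> int) (x : R) :
  signed_takagi r (- x) = signed_takagi r x.
Proof.
congr (limn (series _)); apply/funext => n; congr (_ * _).
by rewrite mulrN dist_intN.
Qed.

Lemma signed_takagi_sym {R : realType} (r : nat -> int) (x : R) :
  signed_takagi r (1 - x) = signed_takagi r x.
Proof. by rewrite addrC signed_takagiD1 signed_takagi_even. Qed.

Lemma signed_takagiN {R : realType} (r : nat -> int) : sign_seq r ->
  signed_takagi (fun n => - r n) = \- signed_takagi r :> (R -> R).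
Proof.
move=> sr; apply/funext => x; rewrite /= /signed_takagi -mulN1r.
rewrite -lim_series_mull; last exact: is_cvg_takagi.
congr (limn (series _)); apply/funext => n.
by rewrite mulN1r intrN !mulNr.
Qed.

Lemma signed_takagi_lower_half {R : realType} (r : nat -> int) (y : R) :
  sign_seq r -> 0 <= y <= 1 -> signed_takagi r (y / 2) =
    (r 0%N)%:~R * (y / 2) + 1 / 2 * signed_takagi (shift_seq r) y.
Proof.
move=> sr y01; rewrite signed_takagi_rec// dist_int_lower_half; last by lra.
by congr (_ + _ * signed_takagi _ _); field.
Qed.

Lemma signed_takagi_upper_half {R : realType} (r : nat -> int) (y : R) :
  sign_seq r -> 0 <= y <= 1 -> signed_takagi r ((1 + y) / 2) =
    (r 0%N)%:~R * ((1 - y) / 2) + 1 / 2 * signed_takagi (shift_seq r) y.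
Proof.
move=> sr y01; rewrite signed_takagi_rec// dist_int_upper_half; last by lra.
rewrite -[in RHS]signed_takagiD1.
by congr (_ * _ + _ * signed_takagi _ _); field.
Qed.

(** A quantitative substitute for uniform convergence, obtained by iterating
    [signed_takagi_rec] [n] times: each step contributes one Lipschitz constant 1
    and halves the oscillation of the remainder. *)
Lemma signed_takagi_near_lipschitz {R : realType} (n : nat) (r : nat -> int)
    (x y : R) : sign_seq r ->
  `|signed_takagi r x - signed_takagi r y| <= n%:R * `|x - y| + 4 * (1 / 2) ^+ n.
Proof.
elim: n r x y => [|n IHn] r x y sr.
  rewrite mul0r add0r expr0 mulr1.
  have := signed_takagi_bound r x sr; have := signed_takagi_bound r y sr.
  by rewrite !ler_norml => ? ?; lra.
have {IHn} := IHn (shift_seq r) (2 * x) (2 * y) (sign_seq_shift _ sr).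
rewrite !(signed_takagi_rec r)//.
have := dist_int_lipschitz x y.
rewrite -mulrBr normrM (ger0_norm (ler0n _ 2)) exprS -[n.+1%:R]natr1.
set D := `|x - y|; set a := dist_int x; set b := dist_int y.
set u := signed_takagi _ _; set v := signed_takagi _ _.
set e := (1 / 2) ^+ n; have -> : n%:R * (2 * D) = 2 * (n%:R * D) by ring.
rewrite [(_ + 1) * D]mulrDl mul1r; set nD := n%:R * D.
rewrite !ler_norml => /andP[? ?] /andP[? ?].
by case: (@sign_seq_intr R r 0 sr) => ->; lra.
Qed.

Lemma signed_takagi_continuous {R : realType} (r : nat -> int) :
  sign_seq r -> continuous (signed_takagi r : R -> R).
Proof.
move=> sr x; apply/cvgrPdist_lt => e e0.
have [|n hn] := @half_pow_small R 4 (e / 2); first by lra.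
have d0 : 0 < e / 2 / n.+1%:R by rewrite divr_gt0//; lra.
exists (e / 2 / n.+1%:R) => //= y /ltW; rewrite ler_pdivlMr// => hy.
apply: (le_lt_trans (signed_takagi_near_lipschitz n _ _ _ sr)).
suff : n%:R * `|x - y| <= e / 2 by lra.
apply: le_trans hy; rewrite mulrC.
by apply: ler_wpM2l => //; rewrite ler_nat.
Qed.

(** * The extrema of signed Takagi functions *)

Lemma half_pow_le1 {R : realType} (t : option nat) : half_pow t <= 1 :> R.
Proof. by case: t => //= n; apply: exprn_ile1; lra. Qed.

(** Upper bound for the tilted function, up to an error that is halved at each
    step of the recursion. *)
Lemma tilted_takagi_le {R : realType} (n : nat) (r : nat -> int) (s : nat)
    (x : R) : sign_seq r -> 0 <= x <= 1 ->
  signed_takagi r x + s%:R * (x - 1 / 2) <=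
    s%:R / 2 + tail_sum r s + 2 * (1 / 2) ^+ n.
Proof.
elim: n r s x => [|n IHn] r s x sr x01.
  have := signed_takagi_bound r x sr; rewrite ler_norml => /andP[_ fx].
  have S0 : 0 <= tail_sum r s :> R by exact: tail_sum_ge0.
  have : 0 <= s%:R * (1 - x) by apply: mulr_ge0 => //; lra.
  by rewrite expr0; lra.
have sr' := sign_seq_shift _ sr; rewrite exprS.
have IH s' (y : R) := IHn _ s' y sr'.
case: s => [|s].
- rewrite !mul0r addr0 add0r.
  (* By symmetry, x lies in the right half; the tilt 0 becomes -r_0, and if this
     is -1 then y is reflected to return to a tilt of +1. *)
  wlog x2 : x x01 / 1 / 2 <= x => [hw|].
    have [|lt] := leP (1 / 2) x; first exact: hw.
    by rewrite -signed_takagi_sym; apply: hw; lra.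
  have [y y01 ->] : exists2 y, 0 <= y <= 1 & x = (1 + y) / 2.
    by exists (2 * x - 1); [lra|field].
  rewrite signed_takagi_upper_half//.
  case: (sr 0%N) => r0.
  + rewrite tail_sum_down// r0 mulrN1z; have := IH 1%N y y01; lra.
  + rewrite tail_sum_up0// r0 mulr1z.
    have /IH -/(_ 1%N) : 0 <= 1 - y <= 1 by lra.
    by rewrite signed_takagi_sym; lra.
- (* On the left half the recursion gives a bound that differs from the claimed
     one through the weight h of level s + 1 for r'; 0 <= h <= 1 suffices. *)
  have := @tail_sum_recl R _ s sr'.
  have := @hit_weight_ge0 R (shift_seq r) s.+1%:Z.
  have : hit_weight (shift_seq r) s.+1%:Z <= 1 :> R by exact: half_pow_le1.
  set h := hit_weight _ _ => h1 h0 hS.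
  have s0 : 0 <= s%:R :> R by [].
  rewrite -[s.+1%:R]natr1.
  have [x2|x2] := leP x (1 / 2).
  + have [y y01 ->] : exists2 y, 0 <= y <= 1 & x = y / 2.
      by exists (2 * x); [lra|field].
    rewrite signed_takagi_lower_half//; case: (sr 0%N) => r0.
    * rewrite tail_sum_down// r0 mulrN1z; have := IH s y y01; lra.
    * rewrite tail_sum_up// r0 mulr1z; have := IH s.+2 y y01.
      by rewrite -[s.+2%:R]natr1 -[s.+1%:R]natr1; lra.
  + have [y y01 ->] : exists2 y, 0 <= y <= 1 & x = (1 + y) / 2.
      by exists (2 * x - 1); [lra|field].
    rewrite signed_takagi_upper_half//; case: (sr 0%N) => r0.
    * rewrite tail_sum_down// r0 mulrN1z; have := IH s.+2 y y01.
      by rewrite -[s.+2%:R]natr1 -[s.+1%:R]natr1; lra.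
    * rewrite tail_sum_up// r0 mulr1z; have := IH s y y01; lra.
Qed.

(** A point where the tilted function nearly reaches that bound.  For s >= 0
    such a point can always be taken in the right half of [0, 1], where the tilt
    becomes s - r_0. *)
Lemma tilted_takagi_ge {R : realType} (n : nat) (r : nat -> int) (s : nat) :
  sign_seq r -> exists2 x : R, 0 <= x <= 1 &
    s%:R / 2 + tail_sum r s - 3 * (1 / 2) ^+ n <=
    signed_takagi r x + s%:R * (x - 1 / 2).
Proof.
elim: n r s => [|n IHn] r s sr.
  exists 1; first by lra.
  have := @signed_takagi_bound R r 1 sr; rewrite ler_norml => /andP[fx _].
  have S1 : tail_sum r s <= 1 :> R by exact: tail_sum_le1.
  by rewrite expr0; lra.
have sr' := sign_seq_shift _ sr; rewrite exprS.
case: s => [|s]; case: (sr 0%N) => r0.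
- have [y y01 hy] := IHn _ 1%N sr'; exists ((1 + y) / 2); first by lra.
  rewrite signed_takagi_upper_half// tail_sum_down// r0 mulrN1z; lra.
(* The new tilt is -1, so the point given for the tilt +1 is reflected. *)
- have [y y01 hy] := IHn _ 1%N sr'; exists ((1 + (1 - y)) / 2); first by lra.
  rewrite signed_takagi_upper_half; [|by []|by lra].
  rewrite signed_takagi_sym tail_sum_up0// r0 mulr1z; lra.
- have [y y01 hy] := IHn _ s.+2 sr'; exists ((1 + y) / 2); first by lra.
  rewrite signed_takagi_upper_half// tail_sum_down// r0 mulrN1z.
  by move: hy; rewrite -[s.+2%:R]natr1 -[s.+1%:R]natr1; lra.
- have [y y01 hy] := IHn _ s sr'; exists ((1 + y) / 2); first by lra.
  rewrite signed_takagi_upper_half// tail_sum_up// r0 mulr1z.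
  by rewrite -[s.+1%:R]natr1; lra.
Qed.

Lemma signed_takagi_max {R : realType} (r : nat -> int) : sign_seq r ->
  (signed_takagi r @` `[0, 1]) (maxval (signed_takagi r : R -> R)) /\
  maxval (signed_takagi r) = tail_sum r 0 :> R.
Proof.
move=> sr; set f : R -> R := signed_takagi r.
have [c c01 fc] : exists2 c : R, c \in `[0, 1] &
    forall t : R, t \in `[0, 1] -> f t <= f c.
  apply: EVT_max => //; apply: continuous_subspaceT.
  exact: signed_takagi_continuous.
have maxE : maxval f = f c.
  apply: le_anti; apply/andP; split.
    apply: ge_sup; first by exists (f c), c.
    by move=> _ [t t01 <-]; apply: fc.
  apply: ub_le_sup; last by exists c.
  by exists (f c) => _ [t t01 <-]; apply: fc.
split; first by rewrite maxE; exists c.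
rewrite maxE; apply: le_anti; apply/andP; split.
  apply: (@le_half_pow _ _ _ 2) => n.
  have := @tilted_takagi_le R n r 0 c sr; rewrite !mul0r addr0 add0r; apply.
  by rewrite in_itv /= in c01.
apply: (@le_half_pow _ _ _ 3) => n.
have [x x01] := @tilted_takagi_ge R n r 0 sr; rewrite !mul0r addr0 add0r.
have : f x <= f c by apply: fc; rewrite in_itv.
by rewrite -/f; lra.
Qed.

Lemma sign_seqN (r : nat -> int) : sign_seq r -> sign_seq (fun n => - r n).
Proof. by move=> sr n; case: (sr n) => ->; [right|left]. Qed.

Lemma minvalE {R : realType} (f : R -> R) : minval f = - maxval (\- f).
Proof. by rewrite /minval /maxval /inf image_comp. Qed.

Lemma signed_takagi_min {R : realType} (r : nat -> int) : sign_seq r ->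
  (signed_takagi r @` `[0, 1]) (minval (signed_takagi r : R -> R)) /\
  minval (signed_takagi r) = - tail_sum (fun n => - r n) 0 :> R.
Proof.
move=> sr; have [] := @signed_takagi_max R _ (sign_seqN r sr).
rewrite signed_takagiN// => -[c c01 fc] maxE; rewrite minvalE maxE; split=> //.
by exists c => //; rewrite -maxE -fc opprK.
Qed.

Lemma tail_sum_eseries {R : realType} (r : nat -> int) : sign_seq r ->
  (tail_sum r 0)%:E =
  (\sum_(0 <= k <oo) (hit_weight r (2 * k + 1)%N%:Z : R)%:E)%E.
Proof.
move=> sr; rewrite /tail_sum -EFin_lim; last exact: is_cvg_tail_sum.
congr (limn _); apply/funext => n; rewrite /= /series /= -sumEFin.
by apply: eq_bigr => k _; rewrite addn0.
Qed.

Lemma tail_sum_hitting {R : realType} (r : nat -> int) : sign_seq r ->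
  (tail_sum r 0)%:E =
  (\sum_(1 <= k <oo) (half_pow (hitting_time r ((2 * k)%N%:Z - 1)%R) : R)%:E)%E.
Proof.
move=> sr; rewrite tail_sum_eseries// -[RHS]nneseries_addn; last first.
  by move=> k; rewrite lee_fin half_pow_ge0.
apply: eq_eseriesr => k _; rewrite /hit_weight; congr (half_pow (hitting_time _ _))%:E.
lia.
Qed.

Lemma tail_sumN_hitting {R : realType} (r : nat -> int) : sign_seq r ->
  (tail_sum (fun n => - r n) 0)%:E =
  (\sum_(1 <= k <oo) (half_pow (hitting_time r (1 - (2 * k)%N%:Z)%R) : R)%:E)%E.
Proof.
move=> sr; rewrite tail_sum_hitting; last exact: sign_seqN.
by apply: eq_eseriesr => k _; rewrite hitting_timeN opprB.
Qed.

Lemma height_tail_sum {R : realType} (r : nat -> int) : sign_seq r ->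
  height (signed_takagi r : R -> R) = tail_sum r 0 + tail_sum (fun n => - r n) 0.
Proof.
move=> sr; rewrite /height (signed_takagi_max r sr).2.
by rewrite (signed_takagi_min r sr).2 opprK.
Qed.

Lemma height_esum_hitting {R : realType} (r : nat -> int) : sign_seq r ->
  ((height (signed_takagi r : R -> R))%:E =
   \esum_(j in [set: int]) (half_pow (hitting_time r (2 * j - 1)%R) : R)%:E)%E.
Proof.
move=> sr; rewrite height_tail_sum// EFinD.
have w0 (t : option nat) : (0 <= (half_pow t : R)%:E)%E.
  by rewrite lee_fin half_pow_ge0.
rewrite (esumID [set j : int | 0 < j])// !setTI; congr (_ + _)%E.
- rewrite (reindex_esum [set: nat] _ (fun k : nat => k.+1%:Z)).
    rewrite -nneseries_esumT// tail_sum_eseries//.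
    by apply: eq_eseriesr => k _; congr (half_pow (hitting_time _ _))%:E; lia.
  split=> [k _ /=|k l _ _|j /= j0]; [lia|by case|].
  by exists `|j|.-1%N => //; lia.
- rewrite (reindex_esum [set: nat] _ (fun k : nat => - k%:Z)).
    rewrite -nneseries_esumT// tail_sum_eseries; last exact: sign_seqN.
    apply: eq_eseriesr => k _; rewrite /hit_weight hitting_timeN.
    by congr (half_pow (hitting_time _ _))%:E; lia.
  split=> [k _ /=|k l _ _ /oppr_inj[]//|j /= j0]; [by apply/negP; lia|].
  by exists `|j|%N => //; lia.
Qed.

(** * The height as a sum over odd times *)

(** The odd times at which the partial sum takes a value not taken before at a
    positive time. *)
Definition new_odd_times (r : nat -> int) : set nat :=
  [set n | odd n /\
    forall m, (0 < m < n)%N -> partial_sum r m <> partial_sum r n].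

Lemma subset_esum_ge0 {R : realType} {T : choiceType} (A B : set T)
    (a : T -> \bar R) : A `<=` B -> (forall i, (0 <= a i)%E) ->
  (\esum_(i in A) a i <= \esum_(i in B) a i)%E.
Proof.
move=> AB a0; rewrite (esumID A B)//.
by rewrite (setIidr AB) leeDl// esum_ge0.
Qed.

Lemma height_esum_times {R : realType} (r : nat -> int) : sign_seq r ->
  ((height (signed_takagi r : R -> R))%:E =
   \esum_(n in new_odd_times r) ((1 / 2 : R) ^+ n)%:E)%E.
Proof.
move=> sr; rewrite height_esum_hitting//.
(* Levels that are never hit contribute 0; on the others the hitting time is a
   bijection onto the new odd times. *)
pose J := [set j : int | hitting_time r (2 * j - 1) <> None].
pose e j := odflt 0%N (hitting_time r (2 * j - 1)).
rewrite (@reindex_esum _ _ _ J _ e).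
  rewrite [RHS]esum_mkcond; apply: eq_esum => j _; rewrite /e.
  case: ifPn => [|/negP Jj].
    by rewrite inE /J /=; case: hitting_time.
  have -> : hitting_time r (2 * j - 1) = None.
    by case E : hitting_time => //; case: Jj; rewrite inE /J /= E.
  by [].
split.
- move=> j; rewrite /J /e /=; case: hittingP => //= n n0 sn nmin _; split.
    have [k] := partial_sum_odd r n sr; rewrite sn.
    by case: (odd n) => //= ?; lia.
  by rewrite sn.
- move=> j k; rewrite !inE /J /e /=.
  case: hittingP => //= n n0 sn _; case: hittingP => //= m m0 sm _ _ _ nm.
  by move: sn; rewrite nm sm; lia.
- move=> n [on nmin]; have [k sn] := partial_sum_odd r n sr.
  rewrite on /= in sn; exists (k + 1); rewrite /J /e /=.
    case: hittingP => //= nv _; apply: (nv n); [by case: (n) on|lia].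
  rewrite (@hitting_unique _ _ (Some n))//; constructor.
  + by case: (n) on.
  + by rewrite sn; lia.
  + by move=> m mn sm; apply: (nmin m mn); rewrite sn sm; lia.
Qed.

Lemma esum_odd_half {R : realType} :
  (\esum_(n in [set n | odd n]) ((1 / 2 : R) ^+ n)%:E = (2 / 3)%:E)%E.
Proof.
rewrite (reindex_esum [set: nat] _ (fun k => (2 * k + 1)%N)); last first.
  split=> [k _ /=|k l _ _|n /= on]; [by rewrite addn1 /= mul2n odd_double|lia|].
  by exists n./2 => //; lia.
have gE : [eta geometric (1 / 2) (1 / 4 : R)] =
    (fun k => (1 / 2 : R) ^+ (2 * k + 1)).
  apply/funext => k; rewrite /= exprD expr1 exprM mulrC.
  by congr (_ ^+ _ * _); field.
have c : series (fun k => (1 / 2 : R) ^+ (2 * k + 1)) @ \oo --> (2 / 3 : R).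
  have e2 : 1 / 2 / (1 - 1 / 4) = 2 / 3 :> R by field.
  rewrite -[X in _ --> X]e2 -gE; apply: cvg_geometric_series.
  by rewrite ger0_norm; lra.
rewrite -nneseries_esumT; last by move=> k; rewrite lee_fin exprn_ge0//; lra.
rewrite -(cvg_lim (@Rhausdorff R) c) -EFin_lim; last by apply: cvgP c.
by congr (limn _); apply/funext => n; rewrite /= /series /= -sumEFin.
Qed.

Lemma height_bounds {R : realType} (r : nat -> int) : sign_seq r ->
  1 / 2 <= height (signed_takagi r : R -> R) <= 2 / 3.
Proof.
move=> sr; have a0 (n : nat) : (0 <= ((1 / 2 : R) ^+ n)%:E)%E.
  by rewrite lee_fin exprn_ge0//; lra.
apply/andP; split; rewrite -lee_fin height_esum_times//.
  rewrite -[leLHS](_ : ((1 / 2 : R) ^+ 1)%:E = _)//.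
  rewrite -(@esum_set1 R _ 1%N (fun n => ((1 / 2 : R) ^+ n)%:E))//.
  apply: subset_esum_ge0 => // _ ->; split=> // m; lia.
by rewrite -esum_odd_half; apply: subset_esum_ge0 => // n [].
Qed.

(** * Heights 1/2 and 2/3 *)

Lemma height_half {R : realType} (r : nat -> int) : sign_seq r ->
  (forall i, partial_sum r (2 * i + 1) = partial_sum r 1) ->
  height (signed_takagi r : R -> R) = 1 / 2.
Proof.
move=> sr s1; apply: EFin_inj; rewrite height_esum_times//.
have -> : new_odd_times r = [set 1%N].
  apply/seteqP; split=> [n [on nmin]|_ ->]; last by split=> // m; lia.
  apply: contrapT => /= n1; apply: (nmin 1%N); first by move: on n1; lia.
  by rewrite -(s1 n./2); congr (partial_sum r _); lia.
by rewrite esum_set1// lee_fin exprn_ge0//; lra.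
Qed.

Lemma height_two_thirds {R : realType} (r : nat -> int) : sign_seq r ->
  height (signed_takagi r : R -> R) = 2 / 3 <->
  forall i k, (i < k)%N -> partial_sum r (2 * i + 1) <> partial_sum r (2 * k + 1).
Proof.
move=> sr; have a0 (n : nat) : (0 <= ((1 / 2 : R) ^+ n)%:E)%E.
  by rewrite lee_fin exprn_ge0//; lra.
split=> [h23 i k ik sik|inj]; last first.
  apply: EFin_inj; rewrite height_esum_times// -esum_odd_half.
  congr esum; apply/seteqP; split=> [n []//|n on]; split=> // m mn smn.
  have [k sm] := partial_sum_odd r m sr; have [l sn] := partial_sum_odd r n sr.
  rewrite [odd n]on in sn.
  have om : odd m by case: (odd m) sm => //=; lia.
  apply: (inj m./2 n./2); first by move: on mn => /=; lia.
  transitivity (partial_sum r m); first by congr (partial_sum r _); lia.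
  by rewrite smn; congr (partial_sum r _); move: on => /=; lia.
(* An odd time that is not new costs its whole weight 2^-N. *)
have [N oN nN] : exists2 N, odd N & ~ new_odd_times r N.
  exists (2 * k + 1)%N; first by rewrite addn1 /= mul2n odd_double.
  by move=> [_ /(_ (2 * i + 1)%N)]; apply; [lia|].
have : ((2 / 3 : R)%:E + ((1 / 2) ^+ N)%:E <= (2 / 3)%:E)%E.
  rewrite -[X in (X%:E + _)%E]h23 height_esum_times// -esum_odd_half.
  rewrite (esumID [set N] [set n | odd n])// addeC.
  rewrite (_ : _ `&` [set N] = [set N]) ?esum_set1//; last first.
    by apply: setIidr => _ ->.
  apply: leeD2r; apply: subset_esum_ge0 => // n En; split; first by case: En.
  by move=> nE; apply: nN; rewrite -nE.
rewrite -EFinD lee_fin; have : 0 < (1 / 2 : R) ^+ N by apply: exprn_gt0; lra.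
lra.
Qed.

(** The sequence e, d, d, d, ... *)
Definition spike_seq (e d : int) : nat -> int :=
  fun n => if n is 0 then e else d.

Lemma sign_spike_seq (e d : int) :
  e = -1 \/ e = 1 -> d = -1 \/ d = 1 -> sign_seq (spike_seq e d).
Proof. by move=> he hd [|n]. Qed.

Lemma partial_sum_spike (e d : int) (n : nat) :
  partial_sum (spike_seq e d) n.+1 = e + d * n%:Z.
Proof.
elim: n => [|n IHn]; first by rewrite partial_sum1 mulr0 addr0.
by rewrite partial_sumSr IHn /=; lia.
Qed.

(** The sequences of maximal height are constant from index 1 on. *)
Lemma height_two_thirds_spike {R : realType} (r : nat -> int) : sign_seq r ->
  height (signed_takagi r : R -> R) = 2 / 3 <->
  exists e d : int, [/\ e = -1 \/ e = 1, d = -1 \/ d = 1 & r = spike_seq e d].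
Proof.
move=> sr; apply: (iff_trans (height_two_thirds r sr)); split; last first.
  move=> [e [d [he hd ->]]] i k ik; rewrite !addn1 !partial_sum_spike.
  by case: hd => ->; lia.
move=> inj; exists (r 0%N), (r 1%N); split=> //.
(* Otherwise s_{2i+3} = s_{2i+1}. *)
have pairE i : r (2 * i + 1)%N = r (2 * i + 2)%N.
  have := inj i i.+1 (ltnSn i).
  rewrite (_ : 2 * i.+1 + 1 = (2 * i + 1).+2)%N; last lia.
  rewrite !partial_sumSr (_ : (2 * i + 1).+1 = 2 * i + 2)%N; last lia.
  by case: (sr (2 * i + 1)%N) => ->; case: (sr (2 * i + 2)%N) => ->; lia.
(* Otherwise the steps r_{2i+1} = r_{2i+2} and r_{2i+3} = r_{2i+4} cancel, so
   that s_{2i+5} = s_{2i+1}. *)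
have stepE i : r (2 * i + 1)%N = r (2 * i + 3)%N.
  have := inj i i.+2 (ltnW (ltnSn i.+1)); have := pairE i; have := pairE i.+1.
  rewrite (_ : 2 * i.+2 + 1 = (2 * i + 1).+4)%N; last lia.
  rewrite !partial_sumSr (_ : (2 * i + 1).+1 = 2 * i + 2)%N; last lia.
  rewrite (_ : (2 * i + 2).+1 = 2 * i + 3)%N; last lia.
  rewrite (_ : (2 * i + 3).+1 = 2 * i + 4)%N; last lia.
  rewrite (_ : 2 * i.+1 + 1 = 2 * i + 3)%N; last lia.
  rewrite (_ : 2 * i.+1 + 2 = 2 * i + 4)%N; last lia.
  move=> <- <-.
  by case: (sr (2 * i + 1)%N) => ->; case: (sr (2 * i + 3)%N) => ->; lia.
have oddE i : r (2 * i + 1)%N = r 1%N.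
  elim: i => // i <-; rewrite (_ : 2 * i.+1 + 1 = 2 * i + 3)%N; last lia.
  by rewrite -stepE.
apply/funext => -[|n] //=; rewrite -(oddE n./2).
have := pairE n./2; case: (boolP (odd n)) => on.
  by move=> ->; congr r; lia.
by move=> _; congr r; lia.
Qed.

Lemma signed_takagi0 {R : realType} (r : nat -> int) :
  signed_takagi r (0 : R) = 0.
Proof.
rewrite /signed_takagi (_ : series _ = cst 0) ?lim_cst//.
apply/funext => n; apply: big1 => i _.
by rewrite mulr0 dist_int_lower_half ?mulr0//; lra.
Qed.

Lemma signed_takagi_at_half {R : realType} (r : nat -> int) : sign_seq r ->
  signed_takagi r (1 / 2 : R) = (r 0%N)%:~R / 2.
Proof.
move=> sr; rewrite signed_takagi_lower_half//; last by lra.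
by rewrite -[X in signed_takagi _ X]add0r signed_takagiD1 signed_takagi0; lra.
Qed.

Lemma signed_takagi_inj {R : realType} (r r' : nat -> int) :
  sign_seq r -> sign_seq r' ->
  signed_takagi r = signed_takagi r' :> (R -> R) -> r = r'.
Proof.
move=> sr sr' ff; apply/funext => n.
elim: n r r' sr sr' ff => [|n IHn] r r' sr sr' ff;
  have r0 : (r 0%N)%:~R = (r' 0%N)%:~R :> R by
    have := congr1 (@^~ (1 / 2)) ff; rewrite /= !signed_takagi_at_half//; lra.
  exact: intr_inj r0.
apply: (IHn (shift_seq r) (shift_seq r')); try exact: sign_seq_shift.
apply/funext => x; have := congr1 (@^~ (x / 2)) ff.
rewrite /= signed_takagi_rec// [in RHS]signed_takagi_rec// r0.
by rewrite (_ : 2 * (x / 2) = x); [lra|field].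
Qed.

Lemma takagi_spike {R : realType} : takagi = signed_takagi (spike_seq 1 1) :> (R -> R).
Proof.
apply/funext => x; congr (limn (series _)); apply/funext => n.
by rewrite -[LHS]mul1r mulrA; case: n.
Qed.

Lemma takagi_tilde_spike {R : realType} :
  takagi_tilde = signed_takagi (spike_seq (-1) 1) :> (R -> R).
Proof.
apply/funext => x; rewrite /takagi_tilde takagi_spike.
rewrite signed_takagi_rec; last by apply: sign_spike_seq; right.
rewrite [RHS]signed_takagi_rec; last by apply: sign_spike_seq; [left|right].
rewrite /= mulrN1z.
have -> : shift_seq (spike_seq 1 1) = shift_seq (spike_seq (-1) 1) by [].
lra.
Qed.

Lemma signed_takagi_spikeN {R : realType} (e d : int) :
  e = -1 \/ e = 1 -> d = -1 \/ d = 1 ->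
  signed_takagi (spike_seq (- e) (- d)) = \- signed_takagi (spike_seq e d)
    :> (R -> R).
Proof.
move=> he hd; rewrite -signed_takagiN; last exact: sign_spike_seq.
by congr signed_takagi; apply/funext => -[].
Qed.

Lemma height_two_thirds_set {R : realType} :
  [set f : R -> R | signed_takagi_class f /\ height f = 2 / 3] =
  [set takagi; \- takagi; takagi_tilde; \- takagi_tilde].
Proof.
have one : (1 : int) = -1 \/ (1 : int) = 1 by right.
have mone : (-1 : int) = -1 \/ (-1 : int) = 1 by left.
have NT : \- takagi = signed_takagi (spike_seq (-1) (-1)) :> (R -> R).
  by rewrite signed_takagi_spikeN// takagi_spike.
have NTt : \- takagi_tilde = signed_takagi (spike_seq 1 (-1)) :> (R -> R).
  by rewrite takagi_tilde_spike -signed_takagi_spikeN// opprK.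
have spike e d : e = -1 \/ e = 1 -> d = -1 \/ d = 1 ->
    let f : R -> R := signed_takagi (spike_seq e d) in
    signed_takagi_class f /\ height f = 2 / 3.
  move=> he hd; have sr := sign_spike_seq e d he hd.
  split; first by exists (spike_seq e d).
  by apply/(height_two_thirds_spike _ sr); exists e, d.
rewrite NT NTt takagi_spike takagi_tilde_spike.
apply/seteqP; split=> [f [[r sr ->] /(height_two_thirds_spike _ sr)]|f].
  by move=> [e [d [[] -> [] -> ->]]]; rewrite /setU /=; tauto.
by move=> [[[]|]|] ->; apply: spike.
Qed.

Lemma card_height_two_thirds {R : realType} :
  ([set f : R -> R | signed_takagi_class f /\ height f = 2 / 3] #= `I_4)%card.
Proof.
pose sgn (b : bool) : int := if b then 1 else -1.
have hsgn b : sgn b = -1 \/ sgn b = 1 by case: b; [right|left].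
pose g n : nat -> int := spike_seq (sgn (odd n)) (sgn (n < 2)%N).
have sg n : sign_seq (g n) by exact: sign_spike_seq.
have -> : [set f : R -> R | signed_takagi_class f /\ height f = 2 / 3] =
    (fun n => signed_takagi (g n) : R -> R) @` `I_4.
  apply/seteqP; split=> [f [[r sr ->] /(height_two_thirds_spike _ sr)]|_ [n _ <-]].
    move=> [e [d [he hd ->]]].
    exists ((e == 1) + (if d == 1 then 0 else 2))%N.
      by case: he => ->; case: hd => ->.
    by case: he => ->; case: hd => ->.
  split; first by exists (g n).
  apply/(height_two_thirds_spike _ (sg n)).
  by exists (sgn (odd n)), (sgn (n < 2)%N).
apply: inj_card_eq => m n; rewrite !inE /= => m4 n4 /signed_takagi_inj gmn.
have {}gmn := gmn (sg m) (sg n).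
have := congr1 (@^~ 0%N) gmn; have := congr1 (@^~ 1%N) gmn; rewrite /g /sgn /=.
by move: m n m4 n4 {gmn} => [|[|[|[|?]]]] [|[|[|[|?]]]].
Qed.

(** Cantor's diagonal argument. *)
Lemma no_injection_bool_seq (G : (nat -> bool) -> nat) : ~ injective G.
Proof.
move=> Ginj; pose b n := `[< exists c, G c = n /\ c n = false >].
have [bG|bG] := boolP (b (G b)); last first.
  by move/asboolP: (bG); apply; exists b; split=> //; exact/negbTE.
have /asboolP[c [/Ginj cb]] := bG.
by rewrite cb bG.
Qed.

(** The sequence 1, e_0, - e_0, e_1, - e_1, ..., where e_i = 1 if [b i] and
    e_i = -1 otherwise; its partial sums of odd length are all 1. *)
Definition zigzag_seq (b : nat -> bool) : nat -> int := fun n =>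
  if n is m.+1 then (if odd m (+) b m./2 then 1 else -1) else 1.

Lemma sign_zigzag_seq (b : nat -> bool) : sign_seq (zigzag_seq b).
Proof. by move=> [|n] /=; [right|case: ifP; [right|left]]. Qed.

Lemma partial_sum_zigzag (b : nat -> bool) (i : nat) :
  partial_sum (zigzag_seq b) (2 * i + 1) = 1.
Proof.
elim: i => [|i IHi]; first by rewrite partial_sum1.
rewrite (_ : 2 * i.+1 + 1 = (2 * i + 1).+2)%N; last lia.
rewrite !partial_sumSr IHi addn1 /= mul2n odd_double uphalf_double doubleK /=.
by case: (b i).
Qed.

Lemma zigzag_seq_inj (b c : nat -> bool) : zigzag_seq b = zigzag_seq c -> b = c.
Proof.
move=> bc; apply/funext => i; have := congr1 (@^~ (2 * i).+1) bc.
by rewrite /= mul2n odd_double doubleK /=; case: (b i); case: (c i).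
Qed.

Lemma uncountable_height_half {R : realType} :
  ~ countable [set f : R -> R | signed_takagi_class f /\ height f = 1 / 2].
Proof.
move=> /countable_injP[F Finj].
apply: (@no_injection_bool_seq (fun b => F (signed_takagi (zigzag_seq b)))).
have hb b : signed_takagi (zigzag_seq b) \in
    [set f : R -> R | signed_takagi_class f /\ height f = 1 / 2].
  have sb := sign_zigzag_seq b.
  rewrite inE; split; first by exists (zigzag_seq b).
  apply: height_half => // i.
  by rewrite partial_sum_zigzag -(partial_sum_zigzag b 0).
move=> b c /Finj bc; apply: zigzag_seq_inj.
by apply: (@signed_takagi_inj R); [| |exact: bc]; exact: sign_zigzag_seq.
Qed.

Theorem theorem1p1 (R : realType) :
  (forall r : nat -> int, sign_seq r ->
    let f : R -> R := signed_takagi r in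
    [/\ (f @` `[0, 1]) (maxval f) /\
        ((maxval f)%:E =
          \sum_(1 <= k <oo) (half_pow (hitting_time r ((2 * k)%N%:Z - 1)%R))%:E)%E,
        (f @` `[0, 1]) (minval f) /\
        ((minval f)%:E =
          - \sum_(1 <= k <oo) (half_pow (hitting_time r (1 - (2 * k)%N%:Z)%R))%:E)%E,
        ((height f)%:E =
          \esum_(j in [set: int]) (half_pow (hitting_time r (2 * j - 1)%R))%:E)%E
      & 1 / 2 <= height f <= 2 / 3]) /\
  ~ countable [set f : R -> R | signed_takagi_class f /\ height f = 1 / 2] /\
  [set f : R -> R | signed_takagi_class f /\ height f = 2 / 3] =
    [set takagi; \- takagi; takagi_tilde; \- takagi_tilde] /\
  ([set f : R -> R | signed_takagi_class f /\ height f = 2 / 3] #= `I_4)%card.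
Proof.
split; [move=> r sr f|split; [|split]].
- split.
  + have [fmax maxE] := @signed_takagi_max R r sr; split=> //.
    by rewrite maxE tail_sum_hitting.
  + have [fmin minE] := @signed_takagi_min R r sr; split=> //.
    by rewrite minE EFinN tail_sumN_hitting.
  + exact: height_esum_hitting.
  + exact: height_bounds.
- exact: uncountable_height_half.
- exact: height_two_thirds_set.
- exact: card_height_two_thirds.
Qed.
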